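(* Let $n \in \mathbb{N}$ be such that $n > 1$. The number of monogenic subsemigroups of $T_n$, up to isomorphism, equals $(n)\mathbf{t} - (n-1)\mathbf{s}$. The number of monogenic inverse subsemigroups of $I_n$, up to isomorphism, equals $(n)\mathbf{i} - (n-1)\mathbf{s}$.
   Context: $\mathbb{N} = \{0, 1, 2, \ldots\}$. Functions are written to the right of their arguments, so $(n)\mathbf{s}$ denotes the value of $\mathbf{s}$ at $n$. For $n \in \mathbb{N}$: $S_n$ is the symmetric group of all permutations of $\{1,\ldots,n\}$; $T_n$ is the full transformation monoid of all functions from $\{1,\ldots,n\}$ to itself under composition; $I_n$ is the symmetric inverse monoid of all bijections between subsets of $\{1,\ldots,n\}$ (including the empty map), under composition of binary relations. Submonoids and inverse submonoids contain the identity of the ambient monoid; subsemigroups and inverse subsemigroups need not. A semigroup $S$ is monogenic if there is $s \in S$ with $S = \{s^j : j \in \mathbb{N},\ j > 0\}$. A monogenic inverse subsemigroup of $I_n$ is a subsemigroup of $I_n$ generated (as a semigroup) by $f$ and $f^{-1}$ for some $f \in I_n$. A monoid $M$ is monogenic if there is $m \in M$ with $M = \{m^j : j \in \mathbb{N}\}$, where $m^0$ is the identity of $M$. An inverse monoid $M$ is a monogenic inverse monoid if there is $m \in M$ such that $M$ is generated as a monoid by $m$ and $m^{-1}$. The functions $\mathbf{s}, \mathbf{t}, \mathbf{i} : \mathbb{N} \to \mathbb{N}$ are defined as follows: - $(n)\mathbf{s}$ is the number of isomorphism types of cyclic subgroups of $S_n$ (equivalently, the number of distinct orders of elements of $S_n$),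 with $(0)\mathbf{s} = 1$ and $(1)\mathbf{s} = 1$; - $(n)\mathbf{t}$ is the number of isomorphism types of monogenic submonoids of $T_n$; - $(n)\mathbf{i}$ is the number of isomorphism types of monogenic inverse submonoids of $I_n$. *)

(* Defs.v *)
From HB Require Import structures.
From mathcomp Require Import all_boot all_order all_algebra all_fingroup.
From mathcomp Require Import all_solvable.
From mathcomp Require Import boolp.

Set Implicit Arguments.
Unset Strict Implicit.
Unset Printing Implicit Defensive.

Local Open Scope group_scope.

(* The points are 'I_n = {0, ..., n-1} rather than {1, ..., n}. As in the
   library's 'S_n, maps act on the right: f * g is "first f, then g". *)

Definition transf (n : nat) : Type := {ffun 'I_n -> 'I_n}.

HB.instance Definition _ n := Finite.copy (transf n) {ffun 'I_n -> 'I_n}.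

Section TransfMonoid.
Variable n : nat.

Definition transf_mul (f g : transf n) : transf n :=
  [ffun x : 'I_n => (g : {ffun 'I_n -> 'I_n}) ((f : {ffun 'I_n -> 'I_n}) x)].

Definition transf_one : transf n := [ffun x : 'I_n => x].

Lemma transf_mulA : associative transf_mul.
Proof. by move=> f g h; apply/ffunP => x; rewrite !ffunE. Qed.

Lemma transf_mul1 : left_id transf_one transf_mul.
Proof. by move=> f; apply/ffunP => x; rewrite !ffunE. Qed.

Lemma transf_mulr1 : right_id transf_one transf_mul.
Proof. by move=> f; apply/ffunP => x; rewrite !ffunE. Qed.

HB.instance Definition _ :=
  isMonoid.Build (transf n) transf_mulA transf_mul1 transf_mulr1.
End TransfMonoid.

(* The graph of a bijection between two subsets: two pairs of R agree on the
   first component iff they agree on the second. *)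
Definition partial_bij n (R : {set 'I_n * 'I_n}) : bool :=
  [forall p in R, forall q in R, (p.1 == q.1) == (p.2 == q.2)].

Record pbij (n : nat) : Type :=
  PBij { pbij_rel : {set 'I_n * 'I_n}; pbij_relP : partial_bij pbij_rel }.

HB.instance Definition _ n := [isSub for @pbij_rel n].
HB.instance Definition _ n := [Finite of pbij n by <:].

Section PbijMonoid.
Variable n : nat.
Implicit Types R S : {set 'I_n * 'I_n}.
Implicit Types f g h : pbij n.

Lemma partial_bijP R :
  reflect {in R &, forall p q, (p.1 == q.1) = (p.2 == q.2)} (partial_bij R).
Proof.
apply: (iffP forall_inP) => [RP p q pR qR | RP p pR].
  by have /forall_inP/(_ q qR)/eqP := RP p pR.
by apply/forall_inP => q qR; rewrite RP.
Qed.

Definition rel_comp R S :=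
  [set p | [exists y, ((p.1, y) \in R) && ((y, p.2) \in S)]].
Definition rel_id : {set 'I_n * 'I_n} := [set p | p.1 == p.2].
Definition rel_conv R := [set p | (p.2, p.1) \in R].

Lemma rel_comp_subproof f g :
  partial_bij (rel_comp (pbij_rel f) (pbij_rel g)).
Proof.
have /partial_bijP RP := pbij_relP f; have /partial_bijP SP := pbij_relP g.
apply/partial_bijP; move=> [a b] [c d]; rewrite !inE /=.
move=> /existsP[y /andP[ay yb]] /existsP[z /andP[cz zd]].
by rewrite (RP _ _ ay cz) (SP _ _ yb zd).
Qed.

Lemma rel_id_subproof : partial_bij rel_id.
Proof. by apply/partial_bijP => p q; rewrite !inE => /eqP-> /eqP->. Qed.

Lemma rel_conv_subproof f : partial_bij (rel_conv (pbij_rel f)).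
Proof.
have /partial_bijP RP := pbij_relP f.
apply/partial_bijP => p q; rewrite !inE /= => pR qR.
by have /= := RP _ _ pR qR.
Qed.

Definition pbij_mul f g : pbij n := PBij (rel_comp_subproof f g).
Definition pbij_one : pbij n := PBij rel_id_subproof.
Definition pbij_inv f : pbij n := PBij (rel_conv_subproof f).

Lemma pbij_mulA : associative pbij_mul.
Proof.
move=> f g h; apply/val_inj/setP => -[a d]; rewrite !inE /=.
apply/existsP/existsP => -[].
- move=> b /andP[ab]; rewrite inE => /existsP[c /andP[bc cd]].
  by exists c; rewrite inE /= cd andbT; apply/existsP; exists b; apply/andP.
- move=> c /andP[]; rewrite inE => /existsP[b /andP[ab bc]] cd.
  by exists b; rewrite ab inE /=; apply/existsP; exists c; apply/andP.
Qed.

Lemma pbij_mul1 : left_id pbij_one pbij_mul.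
Proof.
move=> f; apply/val_inj/setP => -[a b]; rewrite !inE /=.
apply/existsP/idP => [[c]|ab]; first by rewrite inE => /andP[/eqP/= ->].
by exists a; rewrite inE eqxx.
Qed.

Lemma pbij_invK : involutive pbij_inv.
Proof. by move=> f; apply/val_inj/setP => -[a b]; rewrite !inE. Qed.

Lemma pbij_invM : {morph pbij_inv : f g / pbij_mul f g >-> pbij_mul g f}.
Proof.
move=> f g; apply/val_inj/setP => -[a b]; rewrite !inE /=.
by apply: eq_existsb => c; rewrite !inE andbC.
Qed.

HB.instance Definition _ :=
  isStarMonoid.Build (pbij n) pbij_mulA pbij_mul1 pbij_invK pbij_invM.
End PbijMonoid.

Definition semigroup_generated_by (G : magmaType) (A S : {pred G}) : Prop :=
  [/\ {subset A <= S}, mulg_closed S &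
      forall S' : {pred G},
        {subset A <= S'} -> mulg_closed S' -> {subset S <= S'}].

Definition monoid_generated_by (G : monoidType) (A S : {pred G}) : Prop :=
  [/\ {subset A <= S}, monoid_closed S &
      forall S' : {pred G},
        {subset A <= S'} -> monoid_closed S' -> {subset S <= S'}].

Definition monogenic_subsemigroup (G : monoidType) (S : {pred G}) : Prop :=
  mulg_closed S /\
  exists2 s, s \in S &
    forall x, x \in S <-> exists2 j : nat, (0 < j)%N & x = s ^+ j.

Definition monogenic_submonoid (G : monoidType) (S : {pred G}) : Prop :=
  monoid_closed S /\
  exists2 m, m \in S & forall x, x \in S <-> exists j : nat, x = m ^+ j.

(* For G = pbij n, inversion is the converse of relations, which is also the
   inverse operation of every inverse subsemigroup. *)
Definition monogenic_inverse_subsemigroup (G : starMonoidType)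
    (S : {pred G}) : Prop :=
  mulg_closed S /\ exists f : G, semigroup_generated_by (pred2 f f^-1) S.

Definition monogenic_inverse_submonoid (G : starMonoidType)
    (S : {pred G}) : Prop :=
  [/\ monoid_closed S, {in S, forall u, u^-1 \in S} &
      exists2 m, m \in S & monoid_generated_by (pred2 m m^-1) S].

Definition iso_map (G H : magmaType) (A : {pred G}) (B : {pred H})
    (f : G -> H) : Prop :=
  [/\ {in A &, {morph f : x y / x * y}}, {in A &, injective f} &
      forall y, y \in B <-> exists2 x, x \in A & y = f x].

(* Inverses are preserved automatically, so this is also isomorphism of
   inverse semigroups; likewise monoid_iso for inverse monoids. *)
Definition semigroup_iso (G H : magmaType) (A : {pred G}) (B : {pred H}) :
    Prop :=
  exists f : G -> H, iso_map A B f.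

Definition monoid_iso (G H : monoidType) (A : {pred G}) (B : {pred H}) :
    Prop :=
  exists2 f : G -> H, iso_map A B f & f 1 = 1.

(* Number of classes of the equivalence iso among the objects satisfying P. *)
Definition num_types (T : finType) (iso : T -> T -> Prop) (P : T -> Prop) :
    nat :=
  #|equivalence_partition (fun A B => `[< iso A B >]) [set A | `[< P A >]]|.

Definition s_fun (n : nat) : nat :=
  num_types (fun G H : {group 'S_n} => G \isog H)
            (fun G : {group 'S_n} => cyclic G).

Definition t_fun (n : nat) : nat :=
  num_types (fun A B : {set transf n} => monoid_iso A B)
            (fun A : {set transf n} => monogenic_submonoid A).

Definition i_fun (n : nat) : nat :=
  num_types (fun A B : {set pbij n} => monoid_iso A B)
            (fun A : {set pbij n} => monogenic_inverse_submonoid A).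

Definition num_monogenic_subsemigroups_T (n : nat) : nat :=
  num_types (fun A B : {set transf n} => semigroup_iso A B)
            (fun A : {set transf n} => monogenic_subsemigroup A).

Definition num_monogenic_inverse_subsemigroups_I (n : nat) : nat :=
  num_types (fun A B : {set pbij n} => semigroup_iso A B)
            (fun A : {set pbij n} => monogenic_inverse_subsemigroup A).

(* Main.v *)
Require Import Defs.
From mathcomp Require Import all_boot all_order all_algebra.
From mathcomp Require Import all_fingroup all_solvable boolp.

(** Let [M] be the full transformation monoid or the symmetric inverse monoid on
    [n] points, and let [B] range over the semigroups generated by some [f],
    respectively by some [f] and [f^-1]. The monogenic monoids are exactly the
    sets [B] with [1] adjoined ([gen_monoidE]). There are two kinds of [B].

    If [1] is in [B], then [f] is a permutation and [B] is a cyclic group of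
    permutations ([gen_semigroup_with1]). Adjoining [1] changes nothing, and the
    semigroup and monoid types of such [B] agree.

    If [1] is not in [B], then adjoining [1] produces a monoid that is not a
    group, and neither creates nor destroys isomorphisms ([adjoin1_isoE]).

    As monoids, the two kinds are never isomorphic, so the number of monoid
    types is the sum of the numbers of types of the two kinds
    ([count_gen_monoid]). As semigroups, the two kinds share the types of the
    cyclic groups that occur away from the identity, and by inclusion-exclusion the number of semigroup
    types falls short of that sum by the number of shared types
    ([count_gen_semigroup]).

    The shared types are those of the cyclic groups of permutations of [n - 1]
    points ([count_overlap]). A group in [M] whose identity [e] is not [1] acts
    faithfully by permutations on the fixed points of [e], of which there are at
    most [n - 1] ([overlap_cyclic]). Conversely, a group of permutations fixing
    a point is copied to a group with another identity by first applying an
    idempotent that moves, or forgets, only that point ([cyclic_overlap]).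

    The argument is carried out once, for an abstract finite monoid of partial
    transformations ([ptMonoid]), and then applied to the two monoids. *)

Set Implicit Arguments.
Unset Strict Implicit.
Unset Printing Implicit Defensive.

Local Open Scope group_scope.

(** * Counting isomorphism types *)

Section CountingTypes.

(** Choosing for each value [f a] one witness [a], one related [b], and then
    [g b] gives an injection between the two sets of values. Relating arguments
    rather than values spares the construction of any map on classes. *)
Lemma leq_card_imset_rel (S T X Y : finType) (D : {set S}) (E : {set T})
    (f : S -> X) (g : T -> Y) (R : S -> T -> Prop) :
    (forall a, a \in D -> exists2 b, b \in E & R a b) ->
    (forall a a' b b', a \in D -> a' \in D -> b \in E -> b' \in E ->
       R a b -> R a' b' -> g b = g b' -> f a = f a') ->
  (#|f @: D| <= #|g @: E|)%N.
Proof.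
move=> DE gf.
have [h hP] : {h : X -> option Y & forall c, c \in f @: D ->
    exists a b, [/\ a \in D, b \in E, R a b, c = f a & h c = Some (g b)]}.
  apply: (@choice _ _ (fun c o => c \in f @: D ->
    exists a b, [/\ a \in D, b \in E, R a b, c = f a & o = Some (g b)])) => c.
  have [/imsetP[a aD ->]|_] := boolP (c \in f @: D); last by exists None.
  by have [b bE ab] := DE _ aD; exists (Some (g b)) => _; exists a, b.
rewrite -(card_in_imset (f := h) (D := f @: D)); last first.
  move=> c c' /hP[a [b [aD bE ab -> ->]]] /hP[a' [b' [aD' bE' ab' -> ->]]] [].
  exact: gf.
rewrite -(card_imset (mem (g @: E)) (@Some_inj _)).
apply/subset_leq_card/subsetP => _ /imsetP[c /hP[a [b [_ bE _ _ ->]]] ->].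
by rewrite !imset_f.
Qed.

Lemma card_imset_rel (S T X Y : finType) (D : {set S}) (E : {set T})
    (f : S -> X) (g : T -> Y) (R : S -> T -> Prop) :
    (forall a, a \in D -> exists2 b, b \in E & R a b) ->
    (forall b, b \in E -> exists2 a, a \in D & R a b) ->
    (forall a a' b b', a \in D -> a' \in D -> b \in E -> b' \in E ->
       R a b -> R a' b' -> f a = f a' <-> g b = g b') ->
  #|f @: D| = #|g @: E|.
Proof.
move=> DE ED fg; apply/eqP; rewrite eqn_leq; apply/andP; split.
  apply: (leq_card_imset_rel (R := R)) => // a a' b b' aD a'D bE b'E ab ab'.
  by case: (fg a a' b b').
apply: (leq_card_imset_rel (R := fun b a => R a b)) => // b b' a a' bE b'E aD.
by move=> a'D ab ab'; case: (fg a a' b b').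
Qed.

(** The class of [x] is the set of all [z] with [iso x z], and equality of two
    such sets is transported pointwise along the correspondence [R]. *)
Lemma num_types_eq (S T : finType) (iso : S -> S -> Prop)
    (iso' : T -> T -> Prop) (P : S -> Prop) (Q : T -> Prop)
    (R : S -> T -> Prop) :
    (forall x, P x -> exists2 y, Q y & R x y) ->
    (forall y, Q y -> exists2 x, P x & R x y) ->
    (forall x x' y y', P x -> P x' -> Q y -> Q y' -> R x y -> R x' y' ->
       iso x x' <-> iso' y y') ->
  num_types iso P = num_types iso' Q.
Proof.
move=> PQ QP isoP; apply: (card_imset_rel (R := R)).
- by move=> x; rewrite inE => /asboolP/PQ[y Qy xy]; exists y => //;
    rewrite inE; apply/asboolP.
- by move=> y; rewrite inE => /asboolP/QP[x Px xy]; exists x => //;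
    rewrite inE; apply/asboolP.
move=> x x' y y'; rewrite !inE => /asboolP Px /asboolP Px' /asboolP Qy.
move=> /asboolP Qy' xy xy'; split=> /setP cls_eq; apply/setP => z.
- rewrite !inE; case: asboolP => //= /[dup] Qz /QP[w Pw wz].
  have := cls_eq w; rewrite !inE (asboolT Pw) /= => e.
  by rewrite -(asbool_equiv_eq (isoP x w y z _ _ _ _ _ _)) // e;
     apply: asbool_equiv_eq; apply: isoP.
- rewrite !inE; case: asboolP => //= /[dup] Pz /PQ[w Qw wz].
  have := cls_eq w; rewrite !inE (asboolT Qw) /= => e.
  by rewrite (asbool_equiv_eq (isoP x z y w _ _ _ _ _ _)) // e;
     apply/esym/asbool_equiv_eq; apply: isoP.
Qed.

Lemma eq_num_types (T : finType) (iso iso' : T -> T -> Prop)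
    (P Q : T -> Prop) :
    (forall x, P x <-> Q x) ->
    (forall x y, P x -> P y -> iso x y <-> iso' x y) ->
  num_types iso P = num_types iso' Q.
Proof.
move=> PQ isoE; apply: (num_types_eq (R := eq)) => [x /PQ|y /PQ|].
- by exists x.
- by exists y.
by move=> x x' y y' Px Px' _ _ <- <-; apply: isoE.
Qed.

(* Symmetry is only assumed on a class C of objects, because the inverse of
   an isomorphism is multiplicative only if its source is closed under
   products. *)
Variables (T : finType) (C : T -> Prop) (iso : T -> T -> Prop).
Hypothesis iso_refl : forall x, iso x x.
Hypothesis iso_sym : forall x y, C x -> iso x y -> iso y x.
Hypothesis iso_trans : forall x y z, iso x y -> iso y z -> iso x z.
Implicit Types P Q : T -> Prop.

Let cls x := [set y | `[< iso x y >]].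

Lemma iso_classE x y : C x -> cls x = cls y <-> iso x y.
Proof.
move=> Cx; split=> [/setP/(_ y)|xy].
  by rewrite !inE (asboolT (iso_refl y)) => /asboolP.
apply/setP => z; rewrite !inE; apply: asbool_equiv_eq.
by split; apply: iso_trans => //; apply: iso_sym.
Qed.

Lemma num_types_card P : (forall x, P x -> C x) ->
  num_types iso P = #|cls @: [set x | `[< P x >]]|.
Proof.
move=> PC.
apply: (card_imset_rel (R := eq)) => [x Px|y Py|x x' _ _ Px Px' _ _ <- <-].
- by exists x.
- by exists y.
have Cx : C x by apply: PC; move: Px; rewrite inE => /asboolP.
rewrite iso_classE //; split=> [/setP/(_ x')|/iso_classE-/(_ Cx) xx'].
  move: Px'; rewrite !inE => -> /=.
  by rewrite (asboolT (iso_refl x')) => /asboolP.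
apply/setP => z; rewrite !inE.
by have /setP/(_ z) := xx'; rewrite !inE => ->.
Qed.

(** Inclusion-exclusion for the two sets of classes met by [P] and by [Q]; the
    classes met by both are those of the members of [P] isomorphic to some
    member of [Q]. *)
Lemma num_typesU P Q : (forall x, P x -> C x) -> (forall x, Q x -> C x) ->
  (num_types iso (fun x => P x \/ Q x)
     + num_types iso (fun x => P x /\ exists2 y, Q y & iso x y)
   = num_types iso P + num_types iso Q)%N.
Proof.
move=> PC QC; rewrite !num_types_card //; last 2 first.
- by move=> x [/PC].
- by move=> x [/PC|/QC].
rewrite -[RHS]cardsUI -imsetU.
rewrite (_ : [set x | `[< P x \/ Q x >]] =
    [set x | `[< P x >]] :|: [set x | `[< Q x >]]); last first.
  by apply/setP => x; rewrite !inE asbool_or.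
congr (_ + _)%N; apply: eq_card => c; apply/imsetP/setIP => [[x]|].
  rewrite inE => /asboolP[Px [y Qy xy]] ->.
  split; first by rewrite imset_f // inE; apply/asboolP.
  by rewrite (iso_classE y (PC x Px)).2 // imset_f // inE; apply/asboolP.
case=> /imsetP[x]; rewrite inE => /asboolP Px -> /imsetP[y].
rewrite inE => /asboolP Qy /(iso_classE y (PC x Px)) xy.
by exists x => //; rewrite inE; apply/asboolP; split => //; exists y.
Qed.

Lemma num_typesU_disjoint P Q :
    (forall x, P x -> C x) -> (forall x, Q x -> C x) ->
    (forall x y, P x -> Q y -> ~ iso x y) ->
  num_types iso (fun x => P x \/ Q x) = (num_types iso P + num_types iso Q)%N.
Proof.
move=> PC QC PQ; rewrite -num_typesU // [X in (_ + X)%N]num_types_card.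
  rewrite (_ : [set x | _] = set0) ?imset0 ?cards0 ?addn0 //.
  by apply/setP => x; rewrite !inE; apply/asboolP => -[Px [y Qy]]; apply: PQ.
by move=> x [/PC].
Qed.
End CountingTypes.

(** * Isomorphisms of subsemigroups *)

Lemma semigroup_iso_refl (G : magmaType) (A : {pred G}) : semigroup_iso A A.
Proof.
by exists id; split=> // y; split=> [Ay|[x Ax ->] //]; exists y.
Qed.

Lemma semigroup_iso_trans (G H K : magmaType) (A : {pred G}) (B : {pred H})
    (C : {pred K}) :
  semigroup_iso A B -> semigroup_iso B C -> semigroup_iso A C.
Proof.
move=> [f [fM f_inj fB]] [g [gM g_inj gC]].
have fA x : x \in A -> f x \in B by move=> Ax; apply/fB; exists x.
exists (g \o f); split=> [x y Ax Ay|x y Ax Ay|z] /=.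
- by rewrite fM // gM // fA.
- by move/g_inj => /(_ (fA _ Ax) (fA _ Ay)); apply: f_inj.
split=> [/gC[y /fB[x Ax ->] ->]|[x Ax ->]]; first by exists x.
by apply/gC; exists (f x); rewrite ?fA.
Qed.

Lemma semigroup_iso_sym (G : monoidType) (H : magmaType) (A : {pred G})
    (B : {pred H}) :
  mulg_closed A -> semigroup_iso A B -> semigroup_iso B A.
Proof.
move=> A_mul [f [fM f_inj fB]].
have [g gP] : {g : H -> G & forall y, y \in B -> g y \in A /\ f (g y) = y}.
  apply: (@choice _ _ (fun y x => y \in B -> x \in A /\ f x = y)) => y.
  have [/fB[x Ax ->]|_] := boolP (y \in B); last by exists 1.
  by exists x.
have fA x : x \in A -> f x \in B by move=> Ax; apply/fB; exists x.
exists g; split=> [y z By Bz|y z By Bz|x].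
- have [[Ay fy] [Az fz]] := (gP y By, gP z Bz).
  have Byz : y * z \in B by rewrite -fy -fz -fM // fA // A_mul.
  have [Ayz fyz] := gP _ Byz.
  by apply: f_inj => //; rewrite ?A_mul // fyz fM // fy fz.
- by have [[_ {2}<-] [_ {2}<-]] := (gP y By, gP z Bz) => ->.
split=> [Ax|[y By ->]]; last by have [] := gP y By.
exists (f x); first exact: fA.
by have [Agx fgx] := gP _ (fA x Ax); apply: f_inj.
Qed.

(** The preimage [x] of [1] gives [f 1 = f x * f 1 = f (x * 1) = f x = 1]. *)
Lemma iso_map1 (G H : monoidType) (A : {pred G}) (B : {pred H}) f :
  monoid_closed A -> 1 \in B -> iso_map A B f -> f 1 = 1.
Proof.
move=> [A1 _] B1 [fM _ fB]; have [x Ax x1] := (fB 1).1 B1.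
by have := fM _ _ Ax A1; rewrite -x1 mul1g mulg1 -x1.
Qed.

Lemma monoid_isoE (G H : monoidType) (A : {pred G}) (B : {pred H}) :
  monoid_closed A -> 1 \in B -> monoid_iso A B <-> semigroup_iso A B.
Proof.
move=> A_mon B1; split=> [[f fI _]|[f fI]]; first by exists f.
by exists f; last exact: iso_map1 fI.
Qed.

(** * Monoids of partial transformations *)

(** The features shared by the full transformation monoid and the symmetric
    inverse monoid on [m.+1] points. The monoid acts faithfully by partial maps,
    contains every permutation, and contains an element [collapse] which fixes
    every point except [hole], where it is undefined or takes another value.
    The set [gens f] stands for [{f}] in one case and for [{f, f^-1}] in the
    other. Its last two properties say that it does not leave the cyclic group
    of permutations in question when it contains a permutation [s], or when [f]
    is [s] preceded by [collapse]. *)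
Structure ptMonoid (m : nat) := PtMonoid {
  pt_sort :> monoidType;
  pt_finite : Finite pt_sort;
  act : pt_sort -> 'I_m.+1 -> option 'I_m.+1;
  act_inj : forall f g, act f =1 act g -> f = g;
  act1 : forall x, act 1 x = Some x;
  actM : forall f g x, act (f * g) x = obind (act g) (act f x);
  of_perm : 'S_m.+1 -> pt_sort;
  act_of_perm : forall s x, act (of_perm s) x = Some (s x);
  hole : 'I_m.+1;
  collapse : pt_sort;
  act_collapse : forall x, x != hole -> act collapse x = Some x;
  act_collapse_hole : act collapse hole != Some hole;
  gens : pt_sort -> {pred pt_sort};
  gens_self : forall f, f \in gens f;
  gens_of_perm : forall f (s : 'S_m.+1) g,
    of_perm s \in gens f -> g \in gens f ->
    exists2 t, t \in <[s]> & g = of_perm t;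
  gens_collapse : forall (s : 'S_m.+1) g, s hole = hole ->
    g \in gens (collapse * of_perm s) ->
    exists2 t, t \in <[s]> & g = collapse * of_perm t
}.

Coercion pt_finType (m : nat) (M : ptMonoid m) : finType :=
  Finite.Pack (pt_finite M).
Canonical pt_finType.

(** In a finite cyclic group every element is a positive power of the
    generator, hence belongs to the semigroup generated by it. *)
Lemma cycle_expS (gT : finGroupType) (x y : gT) :
  y \in <[x]> -> exists j, y = x ^+ j.+1.
Proof.
case/cycleP => -[|j] ->; last by exists j.
by exists #[x].-1; rewrite prednK ?order_gt0 // expg_order.
Qed.

Lemma fix_lift_perm m (i : 'I_m.+1) (s : 'S_m.+1) :
  s i = i -> exists t : 'S_m, s = lift_perm i i t.
Proof.
move=> si.
have sP j : exists k, lift i k = s (lift i j).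
  have : s (lift i j) != i.
    by rewrite -[X in _ != X]si (inj_eq perm_inj) eq_sym neq_lift.
  by rewrite eq_sym => /unlift_some[k -> _]; exists k.
have [t tE] := choice sP.
have t_inj : injective t.
  move=> j k jk; apply: (@lift_inj _ i); apply: (@perm_inj _ s).
  by rewrite -!tE jk.
exists (perm t_inj); apply/permP => j.
case: (unliftP i j) => [k ->|->]; last by rewrite lift_perm_id.
by rewrite lift_perm_lift permE tE.
Qed.

Section PtMonoid.
Variables (m : nat) (M : ptMonoid m).
Local Notation iota := (of_perm M).
Local Notation eps := (collapse M).
Local Notation h0 := (hole M).
Local Notation semigroup_types :=
  (num_types (fun A B : {set M} => semigroup_iso A B)).
Implicit Types (A B : {set M}) (s t : 'S_m.+1).

Lemma of_permM s t : iota (s * t) = iota s * iota t.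
Proof.
by apply: act_inj => x; rewrite actM !act_of_perm /= act_of_perm permM.
Qed.

Lemma of_perm1 : iota 1 = 1.
Proof. by apply: act_inj => x; rewrite act1 act_of_perm perm1. Qed.

Lemma of_perm_inj : injective iota.
Proof.
move=> s t st; apply/permP => x; apply: Some_inj.
by rewrite -!(act_of_perm M) st.
Qed.

(** A left factor of a permutation is everywhere defined and injective, hence
    bijective because there are finitely many points. *)
Lemma of_perm_factor (f g : M) s : f * g = iota s -> exists t, f = iota t.
Proof.
move=> fgs.
have fP x : exists y, act f x = Some y.
  have := act_of_perm M s x; rewrite -fgs actM.
  by case: (act f x) => // y _; exists y.
have [t tE] := choice fP.
have t_inj : injective t.
  move=> x y txy; apply: (@perm_inj _ s); apply: Some_inj.
  by rewrite -!(act_of_perm M) -fgs !actM !tE txy.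
by exists (perm t_inj); apply: act_inj => x; rewrite act_of_perm permE tE.
Qed.

Definition gen_semigroup A := exists f, semigroup_generated_by (gens f) A.
Definition gen_monoid A := exists f, monoid_generated_by (gens f) A.
Definition cyclic_units A :=
  exists2 G : {group 'S_m.+1}, cyclic G & A = iota @: G.
Definition gen_semigroup_no1 A := gen_semigroup A /\ 1 \notin A.
Definition adjoin1 A : {set M} := (1 : M) |: A.

Lemma in_adjoin1 A (x : M) : reflect (x = 1 \/ x \in A) (x \in adjoin1 A).
Proof. by apply: (iffP setU1P). Qed.

Lemma gen_semigroup_closed A : gen_semigroup A -> mulg_closed A.
Proof. by case=> f []. Qed.

Lemma adjoin1_closed A : mulg_closed A -> monoid_closed (adjoin1 A).
Proof.
move=> A_mul; split=> [|x y]; first by apply/in_adjoin1; left.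
move=> /in_adjoin1[->|Ax] /in_adjoin1[->|Ay]; rewrite ?mul1g ?mulg1;
  apply/in_adjoin1; try (by left); right=> //; exact: A_mul.
Qed.

Lemma adjoin1_id A : 1 \in A -> adjoin1 A = A.
Proof.
by move=> A1; apply/setP => x; apply/in_adjoin1/idP => [[->|]|] //; right.
Qed.

Lemma cyclic_units_closed A : cyclic_units A -> monoid_closed A.
Proof.
move=> [G _ ->]; split=> [|_ _ /imsetP[s Gs ->] /imsetP[t Gt ->]].
  by rewrite -of_perm1 imset_f.
by rewrite -of_permM imset_f ?groupM.
Qed.

Lemma cyclic_units1 A : cyclic_units A -> 1 \in A.
Proof. by case/cyclic_units_closed. Qed.

(** The positive powers of [s] already exhaust its cyclic group, so those of
    [theta s] exhaust the image. The lemma serves for [theta] the inclusion of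
    the permutations, and for this inclusion preceded by the collapse. *)
Lemma image_cycle_gen (theta : 'S_m.+1 -> M) s :
    {in <[s]> &, {morph theta : t u / t * u}} ->
    (forall f, f \in gens (theta s) -> exists2 t, t \in <[s]> & f = theta t) ->
  gen_semigroup (theta @: <[s]>).
Proof.
move=> thM gens_th; exists (theta s); split=> [f /gens_th[t ts ->]||S].
- exact: imset_f.
- move=> _ _ /imsetP[t ts ->] /imsetP[u us ->].
  by rewrite -thM // imset_f ?groupM.
move=> gensS S_mul _ /imsetP[t /cycle_expS[j ->] ->].
elim: j => [|j IHj]; first exact/gensS/gens_self.
by rewrite expgS thM ?mem_cycle ?cycle_id // S_mul //; apply/gensS/gens_self.
Qed.

Lemma cyclic_units_gen A : cyclic_units A -> gen_semigroup A.
Proof.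
move=> [G /cyclicP[s ->] ->]; apply: image_cycle_gen => [t u _ _|f].
  exact: of_permM.
by apply: gens_of_perm; apply: gens_self.
Qed.

(** If no generator were a permutation, then the elements that are not
    permutations would be closed under products by [of_perm_factor] and so
    exhaust the semigroup, contrary to its containing [1]. A permutation [s]
    among the generators puts all of them in the cyclic group of [s]. *)
Lemma gen_semigroup_with1 A : gen_semigroup A -> 1 \in A -> cyclic_units A.
Proof.
move=> [f [fA A_mul A_min]] A1.
have [s sf] : exists s, iota s \in gens f.
  apply/not_existsP => nf.
  have /(_ 1 A1) : {subset A <=
      [pred x : M | (x \in A) && ~~ `[< exists s, x = iota s >]]}.
    apply: A_min => [x fx|x y]; rewrite !inE.
      by rewrite fA //=; apply/asboolP => -[s xs]; case: (nf s); rewrite -xs.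
    move=> /andP[Ax /asboolP nx] /andP[Ay _]; rewrite A_mul //=.
    by apply/asboolP => -[s /of_perm_factor].
  rewrite inE A1 /=; case: asboolP => // -[]; exists 1; by rewrite of_perm1.
exists <[s]>%G; first exact: cycle_cyclic.
apply/setP => x; apply/idP/idP => [|/imsetP[t /cycle_expS[j ->] ->]].
  apply: A_min x => [x /(gens_of_perm sf)[t ts ->]|]; first exact: imset_f.
  move=> _ _ /imsetP[t ts ->] /imsetP[u us ->].
  by rewrite -of_permM imset_f ?groupM.
elim: j => [|j IHj]; first exact: fA.
by rewrite expgS of_permM A_mul // fA.
Qed.

Lemma gen_semigroup_split A :
  gen_semigroup A <-> cyclic_units A \/ gen_semigroup_no1 A.
Proof.
split=> [sA|[/cyclic_units_gen|[]] //].
by case: (boolP (1 \in A)) => A1; [left; apply: gen_semigroup_with1 | right].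
Qed.

Lemma group_semigroup_iso (G : {group 'S_m.+1}) :
  semigroup_iso G (mem (iota @: G)).
Proof.
exists iota; split=> [s t _ _|s t _ _|x]; first exact: of_permM.
  exact: of_perm_inj.
by split=> [/imsetP[s Gs ->]|[s Gs ->]]; [exists s | apply: imset_f].
Qed.

(** Finite cyclic groups are classified by their order. *)
Lemma cyclic_units_isoE A B : cyclic_units A -> cyclic_units B ->
  semigroup_iso A B <-> #|A| = #|B|.
Proof.
move=> [G cG ->] [H cH ->]; split=> [[f [_ f_inj fB]]|].
  rewrite -(card_in_imset f_inj); apply: eq_card => y.
  apply/imsetP/idP => [|By]; first by move/fB.
  exact/fB.
rewrite !card_imset; [|exact: of_perm_inj ..] => GH.
have /isogP[h /injmP h_inj hG] : G \isog H.
  by rewrite (isog_cyclic_card H cG) cH GH eqxx.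
have G_mul : mulg_closed G by move=> s t; apply: groupM.
apply: semigroup_iso_trans (group_semigroup_iso H).
apply: semigroup_iso_trans (semigroup_iso_sym G_mul (group_semigroup_iso G)) _.
exists h; split=> [s t Gs Gt||y]; [exact: morphM|exact: h_inj|].
rewrite -hG; split=> [/morphimP[x _ Gx ->]|[x Gx ->]]; first by exists x.
exact: mem_morphim.
Qed.

Lemma gen_monoidE A :
  gen_monoid A <-> exists2 B, gen_semigroup B & A = adjoin1 B.
Proof.
split=> [[f [fA A_mon A_min]]|[B [f [fB B_mul B_min]] ->]]; last first.
  exists f; split=> [x /fB Bx||S fS [S1 S_mul] x].
  - by apply/in_adjoin1; right.
  - exact: adjoin1_closed.
  - by move=> /in_adjoin1[->|] //; apply: B_min.
pose B : {set M} := [set x : M | `[< forall S : {pred M},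
  {subset gens f <= S} -> mulg_closed S -> x \in S >]].
have BP x : x \in B <-> forall S : {pred M},
    {subset gens f <= S} -> mulg_closed S -> x \in S.
  by rewrite inE; split=> [/asboolP|?]; last exact/asboolP.
have fB : {subset gens f <= B} by move=> x fx; apply/BP => S /(_ x fx).
have B_mul : mulg_closed B.
  by move=> x y /BP Bx /BP By; apply/BP => S fS S_mul; rewrite S_mul ?Bx ?By.
exists B; first by exists f; split=> // S fS S_mul x /BP; apply.
have [A1 A_mul] := A_mon.
apply/setP => x; apply/idP/idP => [|/in_adjoin1[->|/BP]] //; last exact.
apply: A_min x; last exact: adjoin1_closed.
by move=> x fx; apply/in_adjoin1; right; apply: fB.
Qed.

Definition adjoined_monoid A := exists2 B, gen_semigroup_no1 B & A = adjoin1 B.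

Lemma gen_monoid_split A : gen_monoid A <-> cyclic_units A \/ adjoined_monoid A.
Proof.
rewrite gen_monoidE.
split=> [[B /gen_semigroup_split[uB|nB] ->]|[uA|[B [sB _] ->]]].
- by left; rewrite adjoin1_id //; apply: cyclic_units1.
- by right; exists B.
- exists A; first exact: cyclic_units_gen.
  by rewrite adjoin1_id //; apply: cyclic_units1.
- by exists B.
Qed.

(** Only one of the two monoids is a group: the inverse of a generator of [B]
    would be [1] or an element of the semigroup, and either would put [1] in the
    semigroup. *)
Lemma cyclic_units_not_iso A B :
  cyclic_units A -> adjoined_monoid B -> ~ semigroup_iso A B.
Proof.
move=> uA [C [[f [fC C_mul _]] C1] ->] [h hI].
have C'1 : 1 \in adjoin1 C by apply/in_adjoin1; left.
have h1 := iso_map1 (cyclic_units_closed uA) C'1 hI.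
case: uA hI => G _ -> [hM h_inj hB].
have Cf : f \in C by apply/fC/gens_self.
have [_ /imsetP[s Gs ->] fs] : exists2 x, x \in iota @: G & f = h x.
  by apply/hB/in_adjoin1; right.
have fg : f * h (iota s^-1) = 1.
  by rewrite fs -hM ?imset_f ?groupV // -of_permM mulgV of_perm1.
have /in_adjoin1[g1|Cg] : h (iota s^-1) \in adjoin1 C.
- by apply/hB; exists (iota s^-1); rewrite ?imset_f ?groupV.
- by move: C1; rewrite -fg g1 mulg1 Cf.
- by move: C1; rewrite -fg C_mul.
Qed.

(** An isomorphism of semigroups extends by sending [1] to [1]; one of
    monoids sends [1] to [1] by [iso_map1] and so restricts to the rest. *)
Lemma adjoin1_isoE A B : mulg_closed A -> 1 \notin A -> 1 \notin B ->
  semigroup_iso A B <-> semigroup_iso (adjoin1 A) (adjoin1 B).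
Proof.
move=> A_mul A1 B1; split=> [[h [hM h_inj hB]]|iso1].
  have hA x : x \in A -> h x \in B by move=> Ax; apply/hB; exists x.
  pose h' (x : M) : M := if x \in A then h x else 1.
  have h'1 : h' 1 = 1 by rewrite /h' (negPf A1).
  have h'A x : x \in A -> h' x = h x by rewrite /h' => ->.
  exists h'; split=> [x y||y].
  - move=> /in_adjoin1[->|Ax] /in_adjoin1[->|Ay];
      rewrite ?h'1 ?mul1g ?mulg1 ?h'1 //.
    by rewrite !h'A ?A_mul ?hM.
  - move=> x y /in_adjoin1[->|Ax] /in_adjoin1[->|Ay] //; rewrite ?h'1 ?h'A //.
    + by move=> e; move: B1; rewrite e hA.
    + by move=> e; move: B1; rewrite -e hA.
    + exact: h_inj.
  split=> [/in_adjoin1[->|/hB[x Ax ->]]|[x /in_adjoin1[->|Ax] ->]].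
  - by exists 1; rewrite ?h'1 //; apply/in_adjoin1; left.
  - by exists x; rewrite ?h'A //; apply/in_adjoin1; right.
  - by rewrite h'1; apply/in_adjoin1; left.
  - by rewrite h'A //; apply/in_adjoin1; right; apply: hA.
have [h hI] := iso1.
have B'1 : 1 \in adjoin1 B by apply/in_adjoin1; left.
have A'_mon := adjoin1_closed A_mul; have [A'1 _] := A'_mon.
have h1 := iso_map1 A'_mon B'1 hI; have [hM h_inj hB] := hI.
have sA : {subset A <= adjoin1 A} by move=> y Ay; apply/in_adjoin1; right.
exists h; split=> [y z Ay Az|y z Ay Az|y].
- by apply: hM; apply: sA.
- by apply: h_inj; apply: sA.
split=> [By|[z Az ->]].
  have [z /in_adjoin1[->|Az] yz] : exists2 z, z \in adjoin1 A & y = h z.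
  - by apply/hB/in_adjoin1; right.
  - by move: B1; rewrite -h1 -yz By.
  - by exists z.
have /in_adjoin1[hz1|//] : h z \in adjoin1 B by apply/hB; exists z; rewrite ?sA.
have z1 : z = 1 by apply: h_inj; [apply: sA | | rewrite h1].
by move: A1; rewrite -z1 Az.
Qed.

(** * The three counts *)

Lemma count_gen_monoid :
  num_types (fun A B : {set M} => monoid_iso A B) gen_monoid
  = (semigroup_types cyclic_units + semigroup_types gen_semigroup_no1)%N.
Proof.
have nC A : adjoined_monoid A -> monoid_closed A.
  by move=> [B [/gen_semigroup_closed B_mul _] ->]; apply: adjoin1_closed.
have mC A : gen_monoid A -> monoid_closed A.
  by case/gen_monoid_split=> [/cyclic_units_closed|/nC].
rewrite (eq_num_types (iso' := fun A B : {set M} => semigroup_iso A B)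
  gen_monoid_split).
  rewrite (num_typesU_disjoint (C := fun A : {set M} => mulg_closed A)).
  - congr (_ + _)%N; apply/esym.
    apply: (num_types_eq (R := fun B A => A = adjoin1 B)).
    + by move=> B nB; exists (adjoin1 B) => //; exists B.
    + by move=> _ [B nB ->]; exists B.
    move=> B B' _ _ [/gen_semigroup_closed B_mul B1] [_ B'1] _ _ -> ->.
    exact: adjoin1_isoE.
  - by move=> A; apply: semigroup_iso_refl.
  - by move=> A B; apply: semigroup_iso_sym.
  - by move=> A B C; apply: semigroup_iso_trans.
  - by move=> A /cyclic_units_closed[].
  - by move=> A /nC[].
  - exact: cyclic_units_not_iso.
move=> A B /mC A_mon /mC[B1 _].
exact: monoid_isoE.
Qed.

(** These sets represent the types shared by the two kinds of generated
    semigroups, which a sum over the kinds counts twice. *)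
Definition overlap A :=
  cyclic_units A /\ exists2 B, gen_semigroup_no1 B & semigroup_iso A B.

Lemma count_gen_semigroup :
  (semigroup_types gen_semigroup + semigroup_types overlap
  = semigroup_types cyclic_units + semigroup_types gen_semigroup_no1)%N.
Proof.
rewrite (eq_num_types (iso' := fun A B : {set M} => semigroup_iso A B)
  gen_semigroup_split) //.
apply: (num_typesU (C := fun A : {set M} => mulg_closed A)).
- by move=> A; apply: semigroup_iso_refl.
- by move=> A B; apply: semigroup_iso_sym.
- by move=> A B C; apply: semigroup_iso_trans.
- by move=> A /cyclic_units_closed[].
- by move=> A [/gen_semigroup_closed].
Qed.

Lemma collapse_avoids x y : act eps x = Some y -> y != h0.
Proof.
have [-> e|x_hl] := eqVneq x h0.
  by apply: contraNneq (act_collapse_hole M) => y_hl; rewrite e y_hl.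
by rewrite act_collapse // => -[<-].
Qed.

(** A permutation [s] fixing the hole maps the other points among themselves,
    and [eps] takes its values among them; the second [eps] does nothing. *)
Lemma collapse_comm s : s h0 = h0 -> eps * iota s * eps = eps * iota s.
Proof.
move=> s_hl; apply: act_inj => x; rewrite !actM.
case e: (act eps x) => [y|] //=; rewrite act_of_perm /= act_collapse //.
by rewrite -[X in _ != X]s_hl (inj_eq perm_inj) (collapse_avoids e).
Qed.

Lemma cycle_fix s t : s h0 = h0 -> t \in <[s]> -> t h0 = h0.
Proof.
move=> s_hl /cycleP[j ->]; elim: j => [|j IHj]; first by rewrite perm1.
by rewrite expgS permM s_hl.
Qed.

Lemma collapse_permM s : s h0 = h0 ->
  {in <[s]> &, {morph (fun t => eps * iota t) : t u / t * u}}.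
Proof.
move=> s_hl t u ts us /=.
by rewrite mulgA collapse_comm ?(cycle_fix s_hl) // of_permM mulgA.
Qed.

(** The value that [eps] hides, the one at the hole, is the same for all these
    permutations. *)
Lemma collapse_perm_inj s : s h0 = h0 ->
  {in <[s]> &, injective (fun t => eps * iota t)}.
Proof.
move=> s_hl t u ts us tu; apply/permP => x.
have [->|x_hl] := eqVneq x h0; first by rewrite !(cycle_fix s_hl).
have := congr1 (fun f => act f x) tu.
by rewrite !actM act_collapse //= !act_of_perm => -[].
Qed.

Lemma collapse_image_gen s : s h0 = h0 ->
  gen_semigroup_no1 ((fun t => eps * iota t) @: <[s]>).
Proof.
move=> s_hl; split.
  by apply: image_cycle_gen (collapse_permM s_hl) _ => f; apply: gens_collapse.
apply/imsetP => -[t ts /(congr1 (fun f => act f h0)) /=]; rewrite act1 actM.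
case e: (act eps h0) => [y|] //=; rewrite act_of_perm => -[hl_ty].
have := collapse_avoids e; rewrite -(inj_eq (@perm_inj _ t)) -hl_ty.
by rewrite (cycle_fix s_hl) ?eqxx.
Qed.

Lemma collapse_iso s : s h0 = h0 ->
  semigroup_iso (mem (iota @: <[s]>)) (mem ((fun t => eps * iota t) @: <[s]>)).
Proof.
move=> s_hl.
have G_mul : mulg_closed <[s]> by move=> t u; apply: groupM.
apply: semigroup_iso_trans (semigroup_iso_sym G_mul (group_semigroup_iso _)) _.
exists (fun t => eps * iota t); split=> [||x].
- exact: collapse_permM.
- exact: collapse_perm_inj.
by split=> [/imsetP[t]|[t ts ->]]; [exists t | apply/imsetP; exists t].
Qed.

(** A permutation of [m] points extends to one of [m.+1] points fixing the
    hole; preceding its powers by [eps] gives an isomorphic group whose identity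
    is [eps] instead of [1]. *)
Lemma cyclic_overlap (G : {group 'S_m}) : cyclic G ->
  exists2 A, overlap A & #|A| = #|G|.
Proof.
move=> /cyclicP[t ->]; pose s := lift_perm h0 h0 t.
have s_hl : s h0 = h0 by rewrite lift_perm_id.
exists (iota @: <[s]>).
  split; first by exists <[s]>%G => //; apply: cycle_cyclic.
  exists ((fun t => eps * iota t) @: <[s]>); first exact: collapse_image_gen.
  exact: collapse_iso.
have lM : {in setT &, {morph lift_perm h0 h0 : t u / t * u}}.
  by move=> u v _ _; rewrite lift_permM.
pose l := Morphism lM.
have l_inj : 'injm l.
  apply/injmP => u v _ _ /permP uv; apply/permP => j; apply: (@lift_inj _ h0).
  by have := uv (lift h0 j); rewrite /= !lift_perm_lift.
rewrite card_imset; last exact: of_perm_inj.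
by rewrite -(card_injm l_inj (subsetT <[t]>)) morphim_cycle ?inE.
Qed.

(** Let [h] be an isomorphism of a cyclic group onto a semigroup without [1],
    and [e := h 1]. As [e] is not [1], some point [x0] is not fixed by [e]. The
    elements of the image permute the fixed points of [e] and are determined by
    this permutation, since [e] maps its domain into its fixed points. Leaving
    all other points alone, they become permutations that fix [x0], that is,
    permutations of [m] points, and the order of the group is preserved. *)
Lemma overlap_cyclic A : overlap A ->
  exists2 G : {group 'S_m}, cyclic G & #|A| = #|G|.
Proof.
move=> [[G cG ->] [B [_ B1] [h [hM h_inj hB]]]].
pose f s := h (iota s).
have fM s t : s \in G -> t \in G -> f (s * t) = f s * f t.
  by move=> Gs Gt; rewrite /f of_permM hM ?imset_f.
have f_inj s t : s \in G -> t \in G -> f s = f t -> s = t.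
  by move=> Gs Gt /h_inj fst; apply/of_perm_inj/fst; apply: imset_f.
pose e := f 1.
have fe s : s \in G -> f s * e = f s by move=> Gs; rewrite -fM ?mulg1.
have ef s : s \in G -> e * f s = f s by move=> Gs; rewrite -fM ?mul1g.
have /existsP[x0 x0_moved] : [exists x, act e x != Some x].
  apply: contraNT B1 => /existsPn e1.
  suff <- : e = 1 by apply/hB; exists (iota 1); rewrite ?imset_f.
  by apply: act_inj => x; rewrite act1; apply/eqP; have := e1 x; rewrite negbK.
have f_dom s x : s \in G -> act e x = Some x ->
    exists2 y, act (f s) x = Some y & act e y = Some y.
  move=> Gs ex; case fsx: (act (f s) x) => [y|].
    by exists y => //; rewrite -fsx -[in RHS](fe s Gs) actM fsx.
  have : act (f s * f s^-1) x = Some x by rewrite -fM ?groupV // mulgV.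
  by rewrite actM fsx.
(* [psi s] extends the restriction of [f s] to the fixed points of [e] by the
   identity. *)
pose psi s x := if act e x == Some x then odflt x (act (f s) x) else x.
have psiE s x : s \in G -> act e x = Some x -> act (f s) x = Some (psi s x).
  by move=> Gs ex; rewrite /psi ex eqxx; have [y -> _] := f_dom s x Gs ex.
have psi_out s x : act e x != Some x -> psi s x = x.
  by rewrite /psi => /negPf->.
have psiM s t x : s \in G -> t \in G -> psi (s * t) x = psi t (psi s x).
  move=> Gs Gt; have [ex|ex] := eqVneq (act e x) (Some x); last first.
    by rewrite !psi_out.
  apply: Some_inj; have [y fsx ey] := f_dom s x Gs ex.
  have -> : psi s x = y by apply: Some_inj; rewrite -psiE.
  by rewrite -!psiE ?groupM // fM // actM fsx.
have psi1 x : psi 1 x = x.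
  have [ex|/psi_out //] := eqVneq (act e x) (Some x).
  by apply: Some_inj; rewrite -psiE.
have psi_inj s : s \in G -> injective (psi s).
  move=> Gs; apply: (can_inj (g := psi s^-1)) => x.
  by rewrite -psiM ?groupV // mulgV psi1.
have [q qE] : {q : 'S_m.+1 -> 'S_m &
    forall s, s \in G -> forall j, lift x0 (q s j) = psi s (lift x0 j)}.
  apply: (@choice _ _ (fun s (t : 'S_m) =>
    s \in G -> forall j, lift x0 (t j) = psi s (lift x0 j))) => s.
  have [Gs|_] := boolP (s \in G); last by exists 1.
  have [|t st] := @fix_lift_perm _ x0 (perm (psi_inj s Gs)).
    by rewrite permE psi_out.
  by exists t => _ j; rewrite -(lift_perm_lift x0) -st permE.
have qM : {in G &, {morph q : s t / s * t}}.
  move=> s t Gs Gt; apply/permP => j; apply: (@lift_inj _ x0).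
  by rewrite permM !qE ?groupM // psiM.
have q_inj : 'injm (Morphism qM).
  apply/injmP => s t Gs Gt /= /permP qst; apply: f_inj => //.
  have psi_st x : psi s x = psi t x.
    case: (unliftP x0 x) => [j ->|->]; first by rewrite -!qE ?qst.
    by rewrite !psi_out.
  apply: act_inj => x; rewrite -(ef s Gs) -(ef t Gt) !actM.
  case ex: (act e x) => [y|] //=.
  have ey : act e y = Some y.
    have ee : e * e = e := ef 1 (group1 G).
    by rewrite -ex -[in RHS]ee actM ex.
  by rewrite (psiE s y Gs ey) (psiE t y Gt ey) psi_st.
exists (Morphism qM @* G)%G; first exact: morphim_cyclic.
by rewrite /= card_injm // card_imset //; apply: of_perm_inj.
Qed.

Lemma count_overlap :
  semigroup_types overlap = s_fun m.
Proof.
apply: (num_types_eq (R := fun A (G : {group 'S_m}) => #|A| = #|G|)).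
- exact: overlap_cyclic.
- exact: cyclic_overlap.
move=> A B G H [uA _] [uB _] cG cH AG BH.
rewrite cyclic_units_isoE // AG BH (isog_cyclic_card H cG) cH /= eq_sym.
by split=> /eqP.
Qed.

Lemma count_gen :
  (semigroup_types gen_semigroup + s_fun m)%N
  = num_types (fun A B : {set M} => monoid_iso A B) gen_monoid.
Proof. by rewrite count_gen_monoid -count_gen_semigroup -count_overlap. Qed.
End PtMonoid.

(** * Monogenic objects by generation *)

Lemma monogenic_subsemigroupE (G : monoidType) (A : {pred G}) :
  monogenic_subsemigroup A <-> exists s, semigroup_generated_by (pred1 s) A.
Proof.
split=> [[A_mul [s As AE]]|[s [sA A_mul A_min]]].
  exists s; split=> // [x /eqP-> //|S sS S_mul x /AE[[|j] // _ ->]].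
  elim: j => [|j IHj]; first by apply: sS; rewrite inE.
  by rewrite expgS S_mul // sS ?inE.
have As : s \in A by apply: sA; rewrite inE.
split=> //; exists s => // x; split=> [Ax|[[|j] // _ ->]]; last first.
  by elim: j => [|j IHj] //; rewrite expgS A_mul.
apply/asboolP.
apply: (A_min [pred x | `[< exists2 j, (0 < j)%N & x = s ^+ j >]]) => //
  [y|y z].
  by rewrite !inE => /eqP->; apply/asboolP; exists 1%N.
rewrite !inE => /asboolP[i i_gt0 ->] /asboolP[j j_gt0 ->]; apply/asboolP.
by exists (i + j)%N; rewrite ?addn_gt0 ?i_gt0 // expgD.
Qed.

Lemma monogenic_submonoidE (G : monoidType) (A : {pred G}) :
  monogenic_submonoid A <-> exists m, monoid_generated_by (pred1 m) A.
Proof.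
split=> [[A_mon [s As AE]]|[s [sA A_mon A_min]]].
  exists s; split=> // [x /eqP-> //|S sS [S1 S_mul] x /AE[j ->]].
  elim: j => [|j IHj] //.
  by rewrite expgS S_mul // sS ?inE.
have As : s \in A by apply: sA; rewrite inE.
split=> //; exists s => // x; have [A1 A_mul] := A_mon.
split=> [Ax|[j ->]]; last first.
  by elim: j => [|j IHj] //; rewrite expgS A_mul.
apply/asboolP.
apply: (A_min [pred x | `[< exists j, x = s ^+ j >]]) => // [y|].
  by rewrite !inE => /eqP->; apply/asboolP; exists 1%N.
split=> [|y z]; first by apply/asboolP; exists 0%N.
rewrite !inE => /asboolP[i ->] /asboolP[j ->]; apply/asboolP.
by exists (i + j)%N; rewrite expgD.
Qed.

Lemma monogenic_inverse_subsemigroupE (G : starMonoidType) (A : {pred G}) :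
  monogenic_inverse_subsemigroup A <->
  exists f : G, semigroup_generated_by (pred2 f f^-1) A.
Proof. by split=> [[_ //]|[f fA]]; split; [case: fA | exists f]. Qed.

Lemma monogenic_inverse_submonoidE (G : starMonoidType) (A : {pred G}) :
  monogenic_inverse_submonoid A <->
  exists f : G, monoid_generated_by (pred2 f f^-1) A.
Proof.
split=> [[_ _ [f _ fA]]|[f fA]]; first by exists f.
have [f2A A_mon A_min] := fA; have [A1 A_mul] := A_mon.
split=> //; last by exists f => //; apply: f2A; rewrite !inE eqxx.
move=> x Ax.
suff /(_ x Ax) : {subset A <= [pred x | (x \in A) && (x^-1 \in A)]}.
  by rewrite inE => /andP[].
apply: A_min => [y|].
  by rewrite !inE => /orP[]/eqP->; rewrite ?invgK !f2A // !inE eqxx ?orbT.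
split=> [|y z]; first by rewrite inE invg1 A1.
by rewrite !inE invgM => /andP[Ay Ay'] /andP[Az Az']; rewrite !A_mul.
Qed.

(** * The full transformation monoid *)

Section FullTransformationMonoid.
Variable m : nat.
Local Notation T := (transf m.+2).

Let fn (f : T) : 'I_m.+2 -> 'I_m.+2 := (f : {ffun 'I_m.+2 -> 'I_m.+2}).
Let T_act (f : T) (x : 'I_m.+2) := Some (fn f x).
Let T_perm (s : 'S_m.+2) : T := [ffun x => s x].
(* A total map can only leave its hole by sending it to another point, which
   takes at least two points. *)
Let T_collapse : T := [ffun x => if x == ord0 then ord_max else x].

Let T_act_inj f g : T_act f =1 T_act g -> f = g.
Proof. by move=> fg; apply/ffunP => x; have [] := fg x. Qed.

Let T_act1 x : T_act 1 x = Some x.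
Proof. by rewrite /T_act /fn ffunE. Qed.

Let T_actM f g x : T_act (f * g) x = obind (T_act g) (T_act f x).
Proof. by rewrite /T_act /fn ffunE. Qed.

Let T_act_perm s x : T_act (T_perm s) x = Some (s x).
Proof. by rewrite /T_act /fn ffunE. Qed.

Let T_act_collapse x : x != ord0 -> T_act T_collapse x = Some x.
Proof. by rewrite /T_act /fn ffunE => /negPf->. Qed.

Let T_act_collapse_hole : T_act T_collapse ord0 != Some ord0.
Proof. by rewrite /T_act /fn ffunE eqxx. Qed.

Let T_gens_self (f : T) : f \in pred1 f. Proof. by rewrite inE. Qed.

Let T_gens_perm (f : T) (s : 'S_m.+2) (g : T) :
  T_perm s \in pred1 f -> g \in pred1 f ->
  exists2 t, t \in <[s]> & g = T_perm t.
Proof. by move=> /eqP<- /eqP->; exists s; rewrite ?cycle_id. Qed.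

Let T_gens_collapse (s : 'S_m.+2) (g : T) : s ord0 = ord0 ->
  g \in pred1 (T_collapse * T_perm s) ->
  exists2 t, t \in <[s]> & g = T_collapse * T_perm t.
Proof. by move=> _ /eqP->; exists s; rewrite ?cycle_id. Qed.

Definition transf_ptMonoid : ptMonoid m.+1 :=
  PtMonoid (Finite.class T) T_act_inj T_act1 T_actM T_act_perm
    T_act_collapse T_act_collapse_hole T_gens_self T_gens_perm T_gens_collapse.

Lemma count_transf :
  (num_monogenic_subsemigroups_T m.+2 + s_fun m.+1)%N = t_fun m.+2.
Proof.
rewrite /num_monogenic_subsemigroups_T /t_fun.
rewrite (eq_num_types (fun A : {set T} => monogenic_subsemigroupE A)
  (fun _ _ _ _ => iff_refl _)).
rewrite (eq_num_types (fun A : {set T} => monogenic_submonoidE A)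
  (fun _ _ _ _ => iff_refl _)).
exact: (count_gen transf_ptMonoid).
Qed.
End FullTransformationMonoid.

(** * The symmetric inverse monoid *)

Section SymmetricInverseMonoid.
Variable m : nat.
Local Notation I := (pbij m.+1).

Let I_act (f : I) (x : 'I_m.+1) := [pick y | (x, y) \in pbij_rel f].

Let I_actP f x y : I_act f x = Some y <-> (x, y) \in pbij_rel f.
Proof.
have /partial_bijP fP := pbij_relP f.
rewrite /I_act; case: pickP => [z xz|xN]; last by rewrite xN.
split=> [[<-] //|xy]; have := fP _ _ xz xy; rewrite /= eqxx => /esym/eqP->.
by [].
Qed.

Let I_perm_subproof (s : 'S_m.+1) : partial_bij [set p | s p.1 == p.2].
Proof.
apply/partial_bijP => p q; rewrite !inE => /eqP<- /eqP<-.
by rewrite (inj_eq perm_inj).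
Qed.
Let I_perm s : I := PBij (I_perm_subproof s).

Let I_collapse_subproof :
  @partial_bij m.+1 [set p | (p.1 == p.2) && (p.1 != ord0)].
Proof.
by apply/partial_bijP => p q; rewrite !inE => /andP[/eqP<- _] /andP[/eqP<- _].
Qed.
Let I_collapse : I := PBij I_collapse_subproof.

Let I_act_ext f g x : (forall y, I_act f x = Some y <-> g = Some y) ->
  I_act f x = g.
Proof.
case: g => [y|] fg; first exact/fg.
by case e: (I_act f x) => [y|] //; have /fg := e.
Qed.

Let I_act_inj f g : I_act f =1 I_act g -> f = g.
Proof.
move=> fg; apply/val_inj/setP => -[x y].
by apply/idP/idP => /I_actP xy; apply/I_actP; rewrite -xy fg.
Qed.

Let I_act1 x : I_act 1 x = Some x.
Proof. by apply/I_actP; rewrite inE. Qed.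

Let I_actM f g x : I_act (f * g) x = obind (I_act g) (I_act f x).
Proof.
apply: I_act_ext => z; rewrite I_actP inE /=; split.
  by move=> /existsP[y /andP[/I_actP-> /I_actP]].
case e: (I_act f x) => [y|] //= /I_actP yz.
by apply/existsP; exists y; rewrite yz andbT; apply/I_actP.
Qed.

Let I_act_perm s x : I_act (I_perm s) x = Some (s x).
Proof. by apply/I_actP; rewrite inE. Qed.

Let I_act_collapse x : x != ord0 -> I_act I_collapse x = Some x.
Proof. by move=> x0; apply/I_actP; rewrite inE eqxx. Qed.

Let I_act_collapse0 : I_act I_collapse ord0 = None.
Proof. by apply: I_act_ext => y; rewrite I_actP inE /= andbF. Qed.

Let I_act_collapse_hole : I_act I_collapse ord0 != Some ord0.
Proof. by rewrite I_act_collapse0. Qed.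

Let gens (f : I) : {pred I} := pred2 f f^-1.

Let I_gens_self (f : I) : f \in gens f. Proof. by rewrite inE eqxx. Qed.

Let I_permV s : (I_perm s)^-1 = I_perm s^-1.
Proof.
apply/val_inj/setP => -[x y]; rewrite !inE /=.
by apply/eqP/eqP => <-; rewrite ?permK ?permKV.
Qed.

Let I_gens_perm (f : I) (s : 'S_m.+1) (g : I) :
  I_perm s \in gens f -> g \in gens f ->
  exists2 t, t \in <[s]> & g = I_perm t.
Proof.
have gV h : h = I_perm s -> exists2 t, t \in <[s]> & h = I_perm t.
  by exists s; rewrite ?cycle_id.
have gV' h : h = (I_perm s)^-1 -> exists2 t, t \in <[s]> & h = I_perm t.
  by exists s^-1; rewrite ?groupV ?cycle_id // -I_permV.
rewrite !inE => /orP[]/eqP sE /orP[]/eqP->.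
- exact/gV.
- by apply/gV'; rewrite sE.
- by apply/gV'; rewrite sE invgK.
- exact/gV.
Qed.

Let I_gens_collapse (s : 'S_m.+1) (g : I) : s ord0 = ord0 ->
  g \in gens (I_collapse * I_perm s) ->
  exists2 t, t \in <[s]> & g = I_collapse * I_perm t.
Proof.
move=> s0; rewrite inE => /orP[]/eqP->; first by exists s; rewrite ?cycle_id.
exists s^-1; first by rewrite groupV cycle_id.
have eV : I_collapse^-1 = I_collapse.
  apply/val_inj/setP => -[x y]; rewrite !inE /= [y == x]eq_sym.
  by case: eqP => [->|].
have sV0 : s^-1 ord0 = ord0 by rewrite -[in LHS]s0 permK.
rewrite invgM I_permV eV; apply: I_act_inj => x; rewrite !I_actM I_act_perm /=.
have [->|x0] := eqVneq x ord0; first by rewrite sV0 I_act_collapse0.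
have sVx : s^-1 x != ord0 by rewrite -[X in _ != X]sV0 (inj_eq perm_inj).
by rewrite !I_act_collapse //= I_act_perm.
Qed.

Definition pbij_ptMonoid : ptMonoid m :=
  PtMonoid (Finite.class I) I_act_inj I_act1 I_actM I_act_perm
    I_act_collapse I_act_collapse_hole I_gens_self I_gens_perm I_gens_collapse.

Lemma count_pbij :
  (num_monogenic_inverse_subsemigroups_I m.+1 + s_fun m)%N = i_fun m.+1.
Proof.
rewrite /num_monogenic_inverse_subsemigroups_I /i_fun.
rewrite (eq_num_types
  (fun A : {set I} => monogenic_inverse_subsemigroupE A)
  (fun _ _ _ _ => iff_refl _)).
rewrite (eq_num_types
  (fun A : {set I} => monogenic_inverse_submonoidE A)
  (fun _ _ _ _ => iff_refl _)).
exact: (count_gen pbij_ptMonoid).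
Qed.
End SymmetricInverseMonoid.

(** * Semigroup types and monoid types compared *)

Local Open Scope ring_scope.

Theorem corollary2 (n : nat) (hn : (1 < n)%N) :
  (num_monogenic_subsemigroups_T n)%:Z
    = (t_fun n)%:Z - (s_fun (n - 1)%N)%:Z
  /\
  (num_monogenic_inverse_subsemigroups_I n)%:Z
    = (i_fun n)%:Z - (s_fun (n - 1)%N)%:Z.
Proof.
case: n hn => [|[|m]] // _; rewrite subn1 /=.
by split; apply/eqP; rewrite eq_sym GRing.subr_eq -PoszD eqz_nat
  ?count_transf ?count_pbij.
Qed.
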